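(* Let $K$ be a separable metric space and let $f:K\to\mathbb{R}$ be a function of finite Baire index. Then $f$ belongs to $SD(K)$.
   Context: Let $K$ be a separable metric space. $DBSC(K)$ is the set of all $f:K\to\mathbb{R}$ of the form $f=u-v$ with $u,v$ bounded lower semi-continuous on $K$; its members are called $D$-functions. Equivalently (Baire), $f\in DBSC(K)$ iff there is a sequence $(\varphi_j)$ of continuous real functions on $K$ with $\sup_{k\in K}\sum_j|\varphi_j(k)|<\infty$ and $f=\sum_j\varphi_j$ pointwise; $\|f\|_D$ denotes the infimum of $\sup_{k\in K}\sum_j|\varphi_j(k)|$ over all such sequences. $DBSC(K)$ with $\|\cdot\|_D$ is a Banach algebra. A simple $D$-function is a $D$-function taking only finitely many values. $SD(K)$ (the strong $D$-functions) is the set of $f:K\to\mathbb{R}$ for which there is a sequence $(\varphi_n)$ of simple $D$-functions on $K$ with $\|f-\varphi_n\|_D\to0$. For a bounded function $f$ on a metric space $L$, put $\underline{\mathrm{osc}}\,f(x)=\limsup_{y\to x}|f(y)-f(x)|$ and $\mathrm{osc}\,f(x)=\limsup_{y\to x}\underline{\mathrm{osc}}\,f(y)$, where limsups are non-exclusive ($y=x$ allowed), i.e. $\limsup_{y\to x}g(y)=\inf_U\sup_{y\in U}g(y)$ over open neighborhoods $U$ of $x$ in $L$. For bounded $f:K\to\mathbb{R}$ and $\varepsilon>0$, let $\mathrm{os}_0(f,\varepsilon)=K$ and, inductively, $\mathrm{os}_{j+1}(f,\varepsilon)=\{x\in L:\mathrm{osc}(f|_L)(x)\ge\varepsilon\}$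 where $L=\mathrm{os}_j(f,\varepsilon)$ (oscillation computed in the subspace $L$). A bounded function $f$ is of finite Baire index if there is an $n$ with $\mathrm{os}_n(f,\varepsilon)=\emptyset$ for all $\varepsilon>0$. *)

(* Defs.v *)
From HB Require Import structures.
From mathcomp Require Import all_boot all_order all_algebra.
From mathcomp Require Import all_classical all_reals all_analysis.

Set Implicit Arguments.
Unset Strict Implicit.
Unset Printing Implicit Defensive.

Import Order.TTheory GRing.Theory Num.Theory.
Import numFieldNormedType.Exports.

Local Open Scope classical_set_scope.
Local Open Scope ring_scope.

Definition separable_space (T : topologicalType) : Prop :=
  exists2 D : set T, countable D & dense D.

Section DFunctions.
Context {R : realType} {K : metricType R}.

Definition DBSC : set (K -> R) := [set f | exists u v : K -> R,
  [/\ bounded_fun u, bounded_fun v,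
      lower_semicontinuous (EFin \o u), lower_semicontinuous (EFin \o v)
    & f = u \- v]].

Definition simpleD : set (K -> R) := [set f | DBSC f /\ finite_set (range f)].

(* The maximum with 0 only matters when K is empty, where the supremum of a
   family of nonnegative numbers indexed by K has to be 0 and not -oo. *)
Definition sup_abs_sum (phi : nat -> K -> R) : \bar R :=
  maxe 0%E (ereal_sup (range (fun k => (\sum_(0 <= j <oo) `|phi j k|%:E)%E))).

Definition D_representation (f : K -> R) (phi : nat -> K -> R) : Prop :=
  [/\ forall j, continuous (phi j),
      (sup_abs_sum phi < +oo)%E
    & forall k, series (fun j => phi j k) @ \oo --> f k].

(* Extended-real valued: the norm of a function without any representation,
   i.e. of a function outside DBSC, is +oo. *)
Definition Dnorm (f : K -> R) : \bar R :=
  ereal_inf [set sup_abs_sum phi | phi in D_representation f].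

Definition SD : set (K -> R) := [set f | exists phi : nat -> K -> R,
  (forall n, simpleD (phi n)) /\ Dnorm (f \- phi n) @[n --> \oo] --> 0%E].

End DFunctions.

Section BaireIndex.
Context {R : realType} {K : metricType R}.
Implicit Types (f : K -> R) (L : set K) (x : K).

(* For x in L, the filter within L (nbhs x) is generated by the neighborhoods
   of x in the subspace L; these contain x, so the upper limits below are
   non-exclusive. *)
Definition lower_osc L f x : \bar R :=
  limf_esup (fun y => `|f y - f x|%:E) (within L (nbhs x)).

Definition osc L f x : \bar R :=
  limf_esup (lower_osc L f) (within L (nbhs x)).

Fixpoint os (j : nat) f (eps : R) : set K :=
  if j is i.+1 then
    [set x | os i f eps x /\ (eps%:E <= osc (os i f eps) f x)%E]
  else setT.

Definition finite_Baire_index f : Prop :=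
  bounded_fun f /\ exists n, forall eps : R, 0 < eps -> os n f eps = set0.

End BaireIndex.

(* Main.v *)
Require Import Defs.
From HB Require Import structures.
From mathcomp Require Import all_boot all_order all_algebra.
From mathcomp Require Import all_classical all_reals all_analysis.
From mathcomp Require Import ring lra zify.

(** Fix [d > 0] and give [x] the rank [max {j | x \in os j f d}].  Near [x] no
    rank is larger, and the points of the same rank have [f]-values within [d]
    of [f x]; the ranks are bounded by some [n] that does not depend on [d].

    A function [g] is a difference of bounded lower semicontinuous functions,
    with [Dnorm g] at most the sum of bounds of [|g|] and [h], as soon as some
    [h >= 0] satisfies [limsup_(y -> x) (|g y - g x| + h y) <= h x]: then
    [- h + g] and [- h - g] are lower semicontinuous up to constants, and a
    nonnegative lower semicontinuous function is the limit of an increasing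
    sequence of Lipschitz functions (inf-convolutions).

    For [e > 0], on each stratum of constant rank (for [d = e]) a finite
    partition of unity gives a continuous [G] with [|f - e G| <= 2 e]; then
    [g := e * floor G] is within [3 e] of [f], and is locally constant on each
    of [2 n + 2] strata, namely the ranks refined by whether [G] is an integer.
    With [c = 6 e], the function [h] that adds [c] times the refined rank and
    the series [\sum_k c / 2 ^ k * rank_(c / 2 ^ k)] controls [f - g]: when
    [y -> x] within a refined stratum, a jump [d <= c] of [f] drops all the
    ranks with [c / 2 ^ k <= d], whose weights sum to at least [d]; otherwise
    the refined rank drops and pays for the whole jump.  Hence
    [Dnorm (f - g) <= C n * e]. *)

Set Implicit Arguments.
Unset Strict Implicit.
Unset Printing Implicit Defensive.

Import Order.TTheory GRing.Theory Num.Theory.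
Import numFieldNormedType.Exports.

Local Open Scope classical_set_scope.
Local Open Scope ring_scope.

(** * Oscillation sets and the rank they define *)

Section OscillationRank.
Context {R : realType} {K : metricType R}.
Implicit Types (f : K -> R) (L : set K) (x : K) (e : R).

Lemma limf_esup_lt (g : K -> \bar R) L x (e : \bar R) :
  (limf_esup g (within L (nbhs x)) < e)%E ->
  exists2 s, (s < e)%E & \forall y \near x, L y -> (g y <= s)%E.
Proof.
move=> /ereal_inf_lt[_ [V LV <-] Ve].
exists (ereal_sup (g @` V)) => //.
by apply: filterS LV => y Vy; apply: le_ereal_sup_tmp; exists (g y) => //.
Qed.

Lemma limf_esup_le (g : K -> \bar R) L x (s : \bar R) :
  (\forall y \near x, L y -> (g y <= s)%E) ->
  (limf_esup g (within L (nbhs x)) <= s)%E.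
Proof.
move=> Ls; apply: ge_ereal_inf.
exists (ereal_sup (g @` [set y | (g y <= s)%E])).
  by exists [set y | (g y <= s)%E].
by apply: ge_ereal_sup => _ [y + <-].
Qed.

(** A bound [s < e] valid on a neighborhood of [x] is valid near every point of its interior. This
    upper semicontinuity is what makes the sets [os j f e] closed. *)
Lemma near_osc_lt L f x (e : \bar R) : (osc L f x < e)%E ->
  \forall y \near x, (osc L f y < e)%E.
Proof.
move=> /limf_esup_lt[s se /nbhs_interior]; apply: filterS => y Ly.
by apply: le_lt_trans se; exact: limf_esup_le.
Qed.

Lemma near_dist_lt L f x e : L x -> (osc L f x < e%:E)%E ->
  \forall y \near x, L y -> `|f y - f x| < e.
Proof.
(* As upper limits are non-exclusive and [x] is in [L], the bound holds for [lower_osc] at [x]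
   itself. *)
move=> Lx /limf_esup_lt[s se /nbhs_singleton /(_ Lx) lx].
have /limf_esup_lt[t te] := le_lt_trans lx se.
by apply: filterS => y Lyt Ly; rewrite -lte_fin (le_lt_trans (Lyt Ly)).
Qed.

Lemma os_subset f e j : os j.+1 f e `<=` os j f e.
Proof. by move=> x []. Qed.

Lemma near_notin_os f e j x : ~ os j f e x -> \forall y \near x, ~ os j f e y.
Proof.
elim: j x => [x []//|j IH x nos].
have [jx|njx] := pselect (os j f e x); last first.
  by apply: filterS (IH _ njx) => y njy /os_subset.
have /near_osc_lt : (osc (os j f e) f x < e%:E)%E.
  by rewrite ltNge; apply/negP => ?; apply: nos.
by apply: filterS => y oy [_]; rewrite leNgt oy.
Qed.

Lemma near_dist_os f e j x : os j f e x -> ~ os j.+1 f e x ->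
  \forall y \near x, os j f e y -> `|f y - f x| < e.
Proof.
move=> jx nos; apply: near_dist_lt => //.
by rewrite ltNge; apply/negP => ?; apply: nos.
Qed.

Definition oscillation_rank f d r :=
  forall x, \forall y \near x,
    (r y <= r x)%N /\ (r y = r x -> `|f y - f x| < d).

Lemma finite_Baire_index_rank f n : (forall e, 0 < e -> os n f e = set0) ->
  forall d, 0 < d -> exists r : K -> nat,
    (forall x, (r x <= n)%N) /\ oscillation_rank f d r.
Proof.
move=> osn d d0.
(* The index [0] always qualifies, since [os 0 f d] is the whole space, so the maximum is
   attained. *)
pose r x : nat := \max_(j < n.+1 | `[< os j f d x >]) j.
have rn x : (r x <= n)%N by apply/bigmax_leqP => j _; rewrite -ltnS.
have osle i j x : (i <= j)%N -> os j f d x -> os i f d x.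
  elim: j => [|j IH]; first by rewrite leqn0 => /eqP->.
  by rewrite leq_eqVlt ltnS => /predU1P[->//|/IH {}IH /os_subset].
have rP x j : os j f d x <-> (j <= r x)%N.
  split=> [jx|].
    have jn : (j < n.+1)%N.
      rewrite ltnS leqNgt; apply/negP => /ltnW nj.
      by have := osle _ _ _ nj jx; rewrite osn.
    apply: (@leq_bigmax_cond _ _ (fun i => nat_of_ord i) (Ordinal jn)).
    exact/asboolP.
  have [i /asboolP ix rxi] : {i : 'I_n.+1 | `[< os i f d x >] & r x = i}.
    apply: (eq_bigmax_cond (fun j : 'I_n.+1 => nat_of_ord j)).
    by apply/card_gt0P; exists ord0; exact/asboolP.
  by rewrite rxi => ji; exact: osle ix.
exists r; split=> // x.
have rx : os (r x) f d x by apply/rP.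
have nrx : ~ os (r x).+1 f d x by move=> /rP; rewrite ltnn.
apply: filterS2 (near_notin_os nrx) (near_dist_os rx nrx) => y nry ry; split.
  by rewrite leqNgt; apply/negP => /rP.
by move=> ryx; apply/ry/rP; rewrite ryx.
Qed.

End OscillationRank.

(** * Lipschitz regularization from below *)

Section InfConvolution.
Context {R : realType} {K : metricType R}.
Implicit Types (a : K -> R) (x y : K) (c t : R).

Definition infconv a c x : R := inf [set a y + c * mdist x y | y in [set: K]].

Section NonnegativeFunction.
Variable a : K -> R.
Hypothesis a_ge0 : forall x, 0 <= a x.

Lemma infconv_le c x y : 0 <= c -> infconv a c x <= a y + c * mdist x y.
Proof.
move=> c0; apply: ge_inf; last by exists y.
by exists 0 => _ [z _ <-]; rewrite addr_ge0// mulr_ge0// mdist_ge0.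
Qed.

Lemma infconv_ge c x t : (forall y, t <= a y + c * mdist x y) ->
  t <= infconv a c x.
Proof.
move=> tle; apply: lb_le_inf; first by exists (a x + c * mdist x x); exists x.
by move=> _ [y _ <-].
Qed.

Lemma infconv_ge0 c x : 0 <= c -> 0 <= infconv a c x.
Proof.
by move=> c0; apply: infconv_ge => y; rewrite addr_ge0// mulr_ge0// mdist_ge0.
Qed.

Lemma infconv_le_id c x : 0 <= c -> infconv a c x <= a x.
Proof.
by move=> c0; rewrite (le_trans (infconv_le x x c0))// mdistxx mulr0 addr0.
Qed.

Lemma infconv_mono c d x : 0 <= c -> c <= d -> infconv a c x <= infconv a d x.
Proof.
move=> c0 cd; apply: infconv_ge => y; apply: le_trans (infconv_le x y c0) _.
by rewrite lerD2l ler_wpM2r// mdist_ge0.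
Qed.

Lemma infconv_lip c x y : 0 <= c ->
  infconv a c x - infconv a c y <= c * mdist x y.
Proof.
move=> c0; rewrite lerBlDr -lerBlDl; apply: infconv_ge => z.
rewrite lerBlDl (le_trans (infconv_le x z c0))// addrCA lerD2l -mulrDr.
by rewrite ler_wpM2l// metric_triangle.
Qed.

Lemma infconv_continuous c : 0 <= c -> continuous (infconv a c).
Proof.
move=> c0 x; apply/cvgrPdist_le => e e0.
have d0 : 0 < e / (c + 1) by rewrite divr_gt0// ltr_wpDl.
near=> y.
have xy : mdist x y < e / (c + 1).
  by near: y; move: (nbhsx_ballx x _ d0); rewrite ballEmdist.
have cxy : c * mdist x y <= e.
  rewrite (le_trans (ler_wpM2l c0 (ltW xy)))// mulrA ler_pdivrMr ?ltr_wpDl//.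
  by rewrite mulrC ler_wpM2l ?(ltW e0)// lerDl.
rewrite ler_norml (le_trans (infconv_lip x y c0))// andbT.
by rewrite lerNl opprB (le_trans (infconv_lip y x c0))// metric_sym.
Unshelve. all: by end_near. Qed.

(** Points within [d] of [x] contribute at least [t]; farther ones pay the penalty [c * d]. *)
Lemma infconv_near_ge x t : (\forall y \near x, t <= a y) ->
  exists2 d, 0 < d & forall c, 0 <= c -> Num.min t (c * d) <= infconv a c x.
Proof.
move=> /nbhs_ballP[d /= d0 dt]; exists d => // c c0; apply: infconv_ge => y.
rewrite ge_min; have [xy|xy] := ltP (mdist x y) d.
  apply/orP; left; have : t <= a y by apply: dt; rewrite ballEmdist.
  by move=> /le_trans; apply; rewrite lerDl mulr_ge0// mdist_ge0.
by apply/orP; right; rewrite (le_trans (ler_wpM2l c0 xy))// lerDr.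
Qed.

Lemma infconv_gt0 x t c : 0 < t -> (\forall y \near x, t <= a y) -> 0 < c ->
  0 < infconv a c x.
Proof.
move=> t0 /infconv_near_ge[d d0 dt] c0; apply: lt_le_trans (dt c (ltW c0)).
by rewrite lt_min t0 mulr_gt0.
Qed.

Lemma infconv_cvg x : lower_semicontinuous (EFin \o a) ->
  infconv a n%:R x @[n --> \oo] --> a x.
Proof.
move=> lsc; apply/cvgrPdist_le => e e0.
have [V Vx Va] := lsc x (a x - e) ltac:(by rewrite lte_fin ltrBlDr ltrDl).
have [|d d0 dn] := @infconv_near_ge x (a x - e).
  by apply: filterS Vx => y /Va; rewrite lte_fin => /ltW.
near=> n.
rewrite ger0_norm ?subr_ge0 ?infconv_le_id//.
rewrite lerBlDr -lerBlDl; apply: le_trans (dn n%:R _) => //.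
(* Once [n] exceeds [(a x - e) / d], the minimum is [a x - e]. *)
rewrite le_min lexx/= -ler_pdivrMr//.
by near: n; exact: nbhs_infty_ger.
Unshelve. all: by end_near. Qed.

End NonnegativeFunction.
End InfConvolution.

(** * Lower semicontinuous functions as series of nonnegative continuous terms *)

Section Telescope.
Context {R : realType} {K : metricType R}.
Implicit Types (a b g h : K -> R) (x : K).

Definition infconv_diff a (j : nat) x : R :=
  infconv a j%:R x - (if j is i.+1 then infconv a i%:R x else 0).

Lemma infconv_diff_sum a x n :
  \sum_(0 <= j < n.+1) infconv_diff a j x = infconv a n%:R x.
Proof.
elim: n => [|n IH]; first by rewrite big_nat1 /infconv_diff subr0.
by rewrite big_nat_recr//= IH /infconv_diff addrC subrK.
Qed.

Variable a : K -> R.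
Hypothesis a_ge0 : forall x, 0 <= a x.

Lemma infconv_diff_ge0 j x : 0 <= infconv_diff a j x.
Proof.
case: j => [|j]; rewrite /infconv_diff ?subr0 ?infconv_ge0//.
by rewrite subr_ge0 infconv_mono// ler_nat.
Qed.

Lemma infconv_diff_sum_le n x : \sum_(0 <= j < n) infconv_diff a j x <= a x.
Proof.
case: n => [|n]; first by rewrite big_geq.
by rewrite infconv_diff_sum infconv_le_id.
Qed.

Lemma infconv_diff_continuous j : continuous (infconv_diff a j).
Proof.
move=> x; rewrite /infconv_diff; apply: cvgB.
  exact: infconv_continuous.
by case: j => [|j]; [exact: cvg_cst|exact: infconv_continuous].
Qed.

Lemma infconv_diff_cvg x : lower_semicontinuous (EFin \o a) ->
  series (fun j => infconv_diff a j x) @ \oo --> a x.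
Proof.
move=> lsc; rewrite -(cvg_shiftS (series _)).
rewrite (_ : (fun n => _) = fun n : nat => infconv a n%:R x).
  exact: infconv_cvg.
by apply/funext => n; rewrite /series/= infconv_diff_sum.
Qed.

End Telescope.

(** * Norm bounds from a control of the oscillation *)

Section Control.
Context {R : realType} {K : metricType R}.
Implicit Types (a b g h : K -> R) (x : K).

(** Subtract the telescoping series of [a] and [b] term by term: their terms are nonnegative, so the
    absolute values sum to at most [a + b]. *)
Lemma Dnorm_lsc_sub a b (C : R) : 0 <= C ->
  (forall x, 0 <= a x) -> (forall x, 0 <= b x) -> (forall x, a x + b x <= C) ->
  lower_semicontinuous (EFin \o a) -> lower_semicontinuous (EFin \o b) ->
  (Dnorm (a \- b)%R <= C%:E)%E.
Proof.
move=> C0 a0 b0 abC lsca lscb.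
pose phi j x := infconv_diff a j x - infconv_diff b j x.
have phiC : (sup_abs_sum phi <= C%:E)%E.
  rewrite /sup_abs_sum ge_max lee_fin C0; apply: ge_ereal_sup => _ [x _ <-].
  apply: lime_le; first by apply: is_cvg_nneseries => *; rewrite lee_fin.
  apply: nearW => n; rewrite sumEFin lee_fin (le_trans _ (abC x))//.
  apply: le_trans (lerD (infconv_diff_sum_le a0 n x)
    (infconv_diff_sum_le b0 n x)).
  rewrite -big_split/=; apply: ler_sum => j _.
  by rewrite (le_trans (ler_normB _ _))// !ger0_norm// infconv_diff_ge0.
apply: ge_ereal_inf; exists (sup_abs_sum phi) => //; exists phi => //; split.
- by move=> j x; apply: cvgB; exact: infconv_diff_continuous.
- by rewrite (le_lt_trans phiC)// ltry.
- move=> x; rewrite (_ : series _ = fun n =>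
      series (fun j => infconv_diff a j x) n -
      series (fun j => infconv_diff b j x) n).
    by apply: cvgB; exact: infconv_diff_cvg.
  by apply/funext => n; rewrite /series/= -sumrB.
Qed.

Definition oscillation_control g h :=
  forall x e, 0 < e -> \forall y \near x, `|g y - g x| + h y <= h x + e.

Lemma oscillation_control_lsc g h (s C : R) : `|s| = 1 ->
  oscillation_control g h ->
  lower_semicontinuous (EFin \o (fun x => (C - h x + s * g x) / 2)).
Proof.
move=> s1 gh x t; rewrite lte_fin => tx.
(* The allowed error is the whole gap above [t]; the division by 2 lets only half of it be lost. *)
have := gh x (((C - h x + s * g x) / 2 - t)) ltac:(by rewrite subr_gt0).
move=> ghx; eexists; first exact: ghx.
move=> y /= gy; rewrite lte_fin.
have : - `|g y - g x| <= s * g y - s * g x.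
  by rewrite -mulrBr -[`|_ - _|]mul1r -s1 -normrM lerNnormlW.
lra.
Qed.

Variables (g h : K -> R) (M B : R).
Hypotheses (gM : forall x, `|g x| <= M) (hB : forall x, 0 <= h x <= B).
Hypothesis gh : oscillation_control g h.

(** The constant [B + M] makes [a] and [b] nonnegative, and [a + b] is [B + M - h]. *)
Let a x := (B + M - h x + 1 * g x) / 2.
Let b x := (B + M - h x + (- 1) * g x) / 2.

Let gab : g = a \- b.
Proof. by apply/funext => x; rewrite /a /b/=; field. Qed.

Let a_itv x : 0 <= a x <= B + M.
Proof. by rewrite /a; have := gM x; have := hB x; rewrite ler_norml; lra. Qed.

Let b_itv x : 0 <= b x <= B + M.
Proof. by rewrite /b; have := gM x; have := hB x; rewrite ler_norml; lra. Qed.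

Let a_lsc : lower_semicontinuous (EFin \o a).
Proof. by apply: oscillation_control_lsc => //; rewrite normr1. Qed.

Let b_lsc : lower_semicontinuous (EFin \o b).
Proof. by apply: oscillation_control_lsc => //; rewrite normrN normr1. Qed.

Lemma oscillation_control_Dnorm : 0 <= B + M -> (Dnorm g <= (B + M)%:E)%E.
Proof.
move=> BM0; rewrite gab; apply: Dnorm_lsc_sub => // x.
- by have /andP[] := a_itv x.
- by have /andP[] := b_itv x.
- by have /andP[] := hB x; rewrite /a /b; lra.
Qed.

Lemma oscillation_control_DBSC : DBSC g.
Proof.
exists a, b; split => //.
- exists (B + M); split; first exact: num_real.
  move=> t Bt x _; have /andP[? ?] := a_itv x.
  by rewrite /= ger0_norm// ltW// (le_lt_trans _ Bt).
- exists (B + M); split; first exact: num_real.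
  move=> t Bt x _; have /andP[? ?] := b_itv x.
  by rewrite /= ger0_norm// ltW// (le_lt_trans _ Bt).
Qed.

End Control.

(** * Approximation by functions with finitely many values *)

Section SimpleApproximation.
Context {R : realType} {K : metricType R}.
Implicit Types (f g : K -> R) (r p : K -> nat) (x y : K) (d e : R).

(* [w i] is a cut-off function that vanishes where [f] is [2 * e] away from
   [e * v i] in the ranks from [j] on; [G] averages the [v i] accordingly. *)
Lemma level_average f r e (M : R) (j : nat) : 0 < e ->
  (forall x, `|f x| <= M) ->
  oscillation_rank f e r ->
  exists G : K -> R, forall x, r x = j ->
    {for x, continuous G} /\ `|e * G x - f x| <= 2 * e.
Proof.
move=> e0 fM rf.
pose m := (Num.truncn (M / e)).+1.
pose v (i : nat) : R := i%:R - m%:R.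
pose E i := [set y | (j <= r y)%N /\ 2 * e <= `|f y - e * v i|].
(* This is the minimum of 1 and the distance to [E i]. *)
pose w i := infconv (\1_(~` E i) : K -> R) 1.
have ind0 i x : 0 <= (\1_(~` E i) : K -> R) x by rewrite indicE.
have w0 i x : 0 <= w i x by apply: infconv_ge0.
have wC i : continuous (w i) by apply: infconv_continuous.
have wE i x : r x = j -> w i x != 0 -> `|f x - e * v i| < 2 * e.
  move=> rx; apply: contra_neqT; rewrite -leNgt => fx.
  apply/eqP; rewrite eq_le w0 andbT (le_trans (infconv_le_id _ _ _))//.
  by rewrite indicE memNset//=; apply; split; rewrite ?rx.
pose W x := \sum_(i < (2 * m).+1) w i x.
pose V x := \sum_(i < (2 * m).+1) v i * w i x.
have WC : continuous W.
  by apply: (@continuous_big _ _ _ _ _ _ _ _ (fun i : 'I__ => w i)) => [|i _];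
    [exact: add_continuous|exact: wC].
have VC : continuous V.
  apply: (@continuous_big _ _ _ _ _ _ _ _
    (fun i : 'I__ => fun x => v i * w i x)) => [|i _ x].
    exact: add_continuous.
  by apply: cvgM; [exact: cvg_cst|exact: wC].
have W0 x : r x = j -> 0 < W x.
  move=> rx.
  have fm : `|f x / e| <= m%:R.
    rewrite normrM normfV (gtr0_norm e0) ltW//.
    by rewrite (le_lt_trans _ (truncnS_gt _))// ler_pM2r ?invr_gt0.
  (* For this [i], [e * v i] is within [e] of [f x]. Near [x] the only points of rank at least [j]
     have rank [j], where [f] moves by less than [e]; so [E i] stays away from [x] and
     [w i x > 0]. *)
  pose i := Num.truncn (f x / e + m%:R).
  have /truncn_itv : 0 <= f x / e + m%:R by move: fm; rewrite ler_norml; lra.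
  rewrite -/i => /andP[ile ilt].
  have im : (i < (2 * m).+1)%N.
    rewrite ltnS -(ler_nat R) natrM (le_trans ile)//.
    by move: fm; rewrite ler_norml; lra.
  have fxi : `|f x - e * v i| <= e.
    have -> : f x - e * v i = e * (f x / e - v i) by field; rewrite gt_eqF.
    rewrite normrM (gtr0_norm e0) -[leRHS]mulr1 ler_pM2l//.
    by rewrite ler_norml /v; move: ile ilt; rewrite -natr1; lra.
  rewrite /W (bigD1 (Ordinal im))//= ltr_wpDr ?sumr_ge0//.
  apply: (@infconv_gt0 _ _ _ _ _ 1) => //.
  apply: filterS (rf x) => y [ryx ry].
  rewrite indicE mem_set//= /E => -[jy].
  have ryj : r y = r x by apply/eqP; rewrite eqn_leq ryx rx jy.
  rewrite leNgt => /negP; apply.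
  have -> : f y - e * v i = (f y - f x) + (f x - e * v i) by ring.
  by rewrite (le_lt_trans (ler_normD _ _))// mulr_natl mulr2n ltr_leD// ry.
exists (fun x => V x / W x) => x rx; have Wx := W0 x rx; split.
  by apply: cvgM; [exact: VC|apply: cvgV; [rewrite gt_eqF|exact: WC]].
have -> : e * (V x / W x) - f x = (e * V x - f x * W x) / W x.
  by field; rewrite gt_eqF.
rewrite normrM normfV (gtr0_norm Wx) ler_pdivrMr//.
rewrite /V /W !mulr_sumr -sumrB (le_trans (ler_norm_sum _ _ _))//.
rewrite ler_sum// => i _.
have [->|/(wE _ _ rx)/ltW wi] := eqVneq (w i x) 0.
  by rewrite !mulr0 subrr normr0.
rewrite mulrA -mulrBl normrM (ger0_norm (w0 _ _)) ler_wpM2r//.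
by rewrite distrC.
Qed.

Definition constancy_rank (g : K -> R) p :=
  forall x, \forall y \near x, (p y <= p x)%N /\ (p y = p x -> g y = g x).

(** Where [G x] is not an integer, the floor is locally constant and no nearby value is an integer.
    Where it is one, nearby integer values are less than 1 away, hence equal. *)
Lemma near_floor (G : K -> R) x : {for x, continuous G} ->
  \forall y \near x,
    ((G y == (Num.floor (G y))%:~R) <= (G x == (Num.floor (G x))%:~R))%N /\
    ((G y == (Num.floor (G y))%:~R) = (G x == (Num.floor (G x))%:~R) ->
      Num.floor (G y) = Num.floor (G x)).
Proof.
move=> Gx; have [Gxi|Gxn] := eqVneq (G x) (Num.floor (G x))%:~R.
  move/cvgrPdist_lt : Gx => /(_ 1 ltr01); apply: filterS => y Gyx.
  split; first by case: eqP.
  move=> /eqP Gyi; move: Gyx; rewrite {1}Gxi {1}Gyi -intrB -intr_norm.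
  by rewrite (ltr_int _ _ 1) => ?; apply/eqP; rewrite eq_sym -subr_eq0; lia.
have /andP[lG Gr] := floor_itv (G x).
have {}lG : (Num.floor (G x))%:~R < G x by rewrite lt_neqAle eq_sym Gxn.
near=> y.
have ly : (Num.floor (G x))%:~R < G y by near: y; exact: cvgr_gt lG.
have yr : G y < (Num.floor (G x) + 1)%:~R by near: y; exact: cvgr_lt Gr.
have -> : Num.floor (G y) = Num.floor (G x) by apply: floor_def; rewrite ltW.
by rewrite (gt_eqF ly).
Unshelve. all: by end_near. Qed.

Lemma simple_approximation f r e (M : R) (n : nat) : 0 < e ->
  (forall x, `|f x| <= M) -> (forall x, (r x <= n)%N) ->
  oscillation_rank f e r ->
  exists g p, [/\ forall x, (p x <= n.*2.+1)%N, constancy_rank g p,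
    finite_set (range g) & forall x, `|f x - g x| <= 3 * e].
Proof.
move=> e0 fM rn rf.
have [G Gj] := choice (fun j => level_average j e0 fM rf).
pose i x := Num.floor (G (r x) x).
pose q x := G (r x) x == (i x)%:~R.
(* Doubling orders the pairs [(r x, q x)] lexicographically: a drop of [r] outweighs any change of
   the bit [q]. *)
exists (fun x => e * (i x)%:~R), (fun x => (r x).*2 + q x)%N.
have fi x : `|f x - e * (i x)%:~R| <= 3 * e.
  have [_] := Gj (r x) x erefl.
  have /andP[] := floor_itv (G (r x) x); rewrite -/(i x) intrD.
  rewrite -(ler_pM2l e0) -(ltr_pM2l e0) mulrDr mulr1 => ? ?.
  by rewrite !ler_norml => ?; lra.
split=> //.
- by move=> x; rewrite -addn1 leq_add ?leq_double//; case: (q x).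
- move=> x; have [Gx _] := Gj (r x) x erefl.
  apply: filterS2 (rf x) (near_floor Gx) => y [ryx _] []; move: ryx.
  rewrite leq_eqVlt => /predU1P[ryx|ryx _ _].
    rewrite /q /i ryx leq_add2l; split=> // /addnI qq; congr (_ * _%:~R).
    by apply: b; case: eqP qq; case: eqP.
  have ltp : ((r y).*2 + q y < (r x).*2 + q x)%N by lia.
  by split; [exact: ltnW|move=> pyx; rewrite pyx ltnn in ltp].
- pose k := (Num.truncn ((M + 3 * e) / e)).+1.
  apply: (@sub_finite_set _ _
    ((fun j : nat => e * (j%:R - k%:R)) @` `I_(k.*2.+1))).
    move=> _ [x _ <-].
    have : `|(i x)%:~R : R| <= k%:R.
      rewrite ltW// (le_lt_trans _ (truncnS_gt _))// ler_pdivlMr// mulrC.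
      have -> : `|(i x)%:~R : R| = `|e * (i x)%:~R| / e.
        by rewrite normrM (gtr0_norm e0) mulrAC divff ?mul1r ?gt_eqF.
      rewrite mulrCA divff ?gt_eqF// mulr1.
      by have := fM x; have := fi x; rewrite !ler_norml; lra.
    rewrite -intr_norm -[k%:R]/(k%:Z%:~R) ler_int => ik.
    exists (absz (i x + k%:Z)); first by rewrite /=; lia.
    have -> : (absz (i x + k%:Z))%:R = (i x + k%:Z)%:~R :> R.
      by rewrite -[LHS]/((absz (i x + k%:Z))%:Z%:~R); congr (_%:~R); lia.
    by rewrite intrD addrK.
  exact/finite_image/finite_II.
Qed.

End SimpleApproximation.

(** * Control of the error by a dyadic series of ranks *)

Section DyadicControl.
Context {R : realType} {K : metricType R}.
Implicit Types (x y : K) (c d : R).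

Definition dyadic c (k : nat) : R := c / (2 ^ k)%:R.

Lemma dyadicS c k : dyadic c k.+1 = dyadic c k / 2.
Proof. by rewrite /dyadic expnS natrM invfM mulrA mulrAC. Qed.

Lemma dyadic_gt0 c k : 0 < c -> 0 < dyadic c k.
Proof. by move=> c0; rewrite divr_gt0// ltr0n expn_gt0. Qed.

Lemma dyadic_small c d : 0 < c -> 0 < d -> exists k, dyadic c k <= d.
Proof.
move=> c0 d0; exists (Num.truncn (c / d)).+1.
rewrite ler_pdivrMr ?ltr0n ?expn_gt0// mulrC -ler_pdivrMr// ltW//.
by rewrite (lt_le_trans (truncnS_gt _))// ler_nat ltnW// ltn_expl.
Qed.

(** The largest [dyadic c k] not above [d] is at least [d / 2] when [d > 0], and the full geometric
    series from it on is twice that term; [2 * dyadic c m] is the part cut off. *)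
Lemma le_sum_dyadic c d m : 0 < c -> d <= c ->
  d <= \sum_(k < m) (if dyadic c k <= d then dyadic c k else 0) +
    2 * dyadic c m.
Proof.
move=> c0 dc; elim: m => [|m IH].
  by rewrite big_ord0 add0r /dyadic expn0 divr1; lra.
rewrite big_ord_recr/= dyadicS; case: (leP (dyadic c m) d) => Td; first by lra.
have : 0 <= \sum_(k < m) (if dyadic c k <= d then dyadic c k else 0).
  by apply: sumr_ge0 => k _; case: ifP => // _; rewrite ltW// dyadic_gt0.
by lra.
Qed.

Variables (f g : K -> R) (p : K -> nat) (N : nat -> K -> nat) (c : R) (n : nat).
Hypothesis c_gt0 : 0 < c.
Hypothesis Nn : forall k x, (N k x <= n)%N.
Hypothesis Nf : forall k, oscillation_rank f (dyadic c k) (N k).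
Hypothesis gp : constancy_rank g p.
Hypothesis fg : forall x, `|f x - g x| <= c / 2.

Let H m x := \sum_(k < m) dyadic c k * (N k x)%:R.
Let D x := sup (range (H^~ x)).

(** The added term bounds the tail of the series from [m] on, as all ranks are at most [n]. So [D]
    lies between [H m] and [H m] plus this term. *)
Let H_decr m x :
  H m.+1 x + 2 * n%:R * dyadic c m.+1 <= H m x + 2 * n%:R * dyadic c m.
Proof.
rewrite /H big_ord_recr/= dyadicS.
have := Nn m x; rewrite -(ler_nat R) -(ler_pM2l (dyadic_gt0 m c_gt0)); lra.
Qed.

Let H_nondecr x : nondecreasing_seq (H^~ x).
Proof.
apply/nondecreasing_seqP => m; rewrite /H big_ord_recr/= lerDl.
by rewrite mulr_ge0// ltW// dyadic_gt0.
Qed.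

Let H_le m k x : H k x <= H m x + 2 * n%:R * dyadic c m.
Proof.
have T0 j : 0 <= 2 * n%:R * dyadic c j by rewrite !mulr_ge0// ltW// dyadic_gt0.
have [km|mk] := leqP k m; first by rewrite ler_wpDr// H_nondecr.
apply: (@le_trans _ _ (H k x + 2 * n%:R * dyadic c k)).
  by rewrite ler_wpDr.
have /nonincreasing_seqP : forall j, H j.+1 x + 2 * n%:R * dyadic c j.+1 <=
  H j x + 2 * n%:R * dyadic c j by move=> j; exact: H_decr.
by apply; exact: ltnW.
Qed.

Let H_le_D m x : H m x <= D x.
Proof.
apply: ub_le_sup; last by exists m.
by exists (H 0 x + 2 * n%:R * dyadic c 0) => _ [k _ <-]; exact: H_le.
Qed.

Let D_le_H m x : D x <= H m x + 2 * n%:R * dyadic c m.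
Proof.
by apply: ge_sup => [|_ [k _ <-]]; [exists (H 0 x); exists 0%N|exact: H_le].
Qed.

(** At a threshold not exceeding the jump, equal ranks are excluded, so the rank drops by at least
    1; no other rank grows. Only finitely many neighborhoods are intersected. *)
Let near_H m x : \forall y \near x,
  \sum_(k < m) (if dyadic c k <= `|f y - f x| then dyadic c k else 0) +
    H m y <= H m x.
Proof.
elim: m => [|m IH]; first by apply: nearW => y; rewrite /H !big_ord0 addr0.
apply: filterS2 IH (Nf m x) => y IH [Nle Neq].
rewrite /H !big_ord_recr/= addrACA lerD//.
have T0 := dyadic_gt0 m c_gt0.
case: ifP => Tf; last by rewrite add0r ler_pM2l// ler_nat.
rewrite -[X in X + _]mulr1 -mulrDr ler_pM2l// nat1r ler_nat.
rewrite ltn_neqAle Nle andbT.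
by apply/eqP => /Neq; rewrite ltNge Tf.
Qed.

Lemma dyadic_control : exists h : K -> R,
  (forall x, 0 <= h x <= 2 * n%:R * c + c * (p x)%:R) /\
  oscillation_control (f \- g) h.
Proof.
exists (fun x => D x + c * (p x)%:R); split=> [x|x e e0].
  have := H_le_D 0 x; have := D_le_H 0 x.
  rewrite /H !big_ord0 /dyadic expn0 divr1.
  have : 0 <= c * (p x)%:R by rewrite mulr_ge0// ltW.
  by lra.
have C0 : 0 < (2 * n%:R + 2) * c by rewrite mulr_gt0// ltr_wpDl// mulr_ge0.
(* Two errors must fit into [e]: the tail [2 * n%:R * dyadic c m] of [D], and the [2 * dyadic c m]
   of [le_sum_dyadic]. *)
have [m me] := dyadic_small C0 e0.
have {}me : 2 * n%:R * dyadic c m + 2 * dyadic c m <= e.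
  by rewrite -mulrDl /dyadic mulrA.
have T0 := dyadic_gt0 m c_gt0.
have nT0 : 0 <= 2 * n%:R * dyadic c m by rewrite !mulr_ge0// ltW.
apply: filterS2 (gp x) (near_H m x) => y [pyx py] /= Hyx.
have := H_le_D m x; have := D_le_H m y => Dy Dx.
have osc_le : `|f y - g y - (f x - g x)| <= c.
  by rewrite (le_trans (ler_normB _ _))// [leRHS](splitr c) lerD.
have S0 : 0 <= \sum_(k < m)
    (if dyadic c k <= `|f y - f x| then dyadic c k else 0).
  by apply: sumr_ge0 => k _; case: ifP => // _; rewrite ltW// dyadic_gt0.
move: pyx; rewrite leq_eqVlt => /predU1P[pyx|pyx].
  move: osc_le; rewrite (py pyx) pyx.
  rewrite (_ : f y - g x - (f x - g x) = f y - f x); last by ring.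
  by move=> /(le_sum_dyadic m c_gt0); lra.
(* Here [p] drops, which frees [c] and pays for a jump of [f - g] of at most [c]. *)
have : c * (p y)%:R + c <= c * (p x)%:R.
  by rewrite -[X in _ + X]mulr1 -mulrDr ler_pM2l// natr1 ler_nat.
by lra.
Qed.

End DyadicControl.

(** * Simple approximants and convergence in norm *)

Section Main.
Context {R : realType} {K : metricType R}.
Implicit Types (f g : K -> R).

Lemma constancy_rank_DBSC g (p : K -> nat) (M : R) (n : nat) : 0 <= M ->
  (forall x, `|g x| <= M) -> (forall x, (p x <= n)%N) -> constancy_rank g p ->
  DBSC g.
Proof.
move=> M0 gM pn gp.
(* A jump of [g] is at most [2 * M] and forces [p] to drop. *)
apply: (@oscillation_control_DBSC _ _ g (fun x => 2 * M * (p x)%:R)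
  M (2 * M * n%:R)) => //.
  by move=> x; rewrite mulr_ge0 ?mulr_ge0//= ler_wpM2l ?mulr_ge0// ler_nat.
move=> x e e0; apply: filterS (gp x) => y [+ py].
rewrite leq_eqVlt => /predU1P[pyx|pyx].
  by rewrite py// pyx subrr normr0 add0r lerDl ltW.
rewrite ler_wpDr ?(ltW e0)//.
have : `|g y - g x| <= M + M by rewrite (le_trans (ler_normB _ _))// lerD.
have : 2 * M * ((p y)%:R + 1) <= 2 * M * (p x)%:R.
  by rewrite ler_wpM2l ?mulr_ge0// natr1 ler_nat.
by lra.
Qed.

Lemma Dnorm_ge0 f : (0 <= Dnorm f)%E.
Proof.
by apply: le_ereal_inf_tmp => _ [phi _ <-]; rewrite /sup_abs_sum le_max lexx.
Qed.

Lemma simpleD_approximation f (M : R) (n : nat) (e : R) : 0 < e ->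
  (forall x, `|f x| <= M) -> (forall d, 0 < d -> os n f d = set0) ->
  exists g, simpleD g /\ (Dnorm (f \- g)%R <= ((24 * n%:R + 9) * e)%:E)%E.
Proof.
move=> e0 fM osn.
have [r [rn rf]] := finite_Baire_index_rank osn e0.
have [g [p [pn gp gfin fg]]] := simple_approximation e0 fM rn rf.
(* With [c = 6 * e], the error [3 * e] is [c / 2]. Then [h <= 2 * n * c + c * (2 * n + 1) = (24 * n
   + 6) * e], and the bound [3 * e] on [f - g] is added. *)
have c0 : 0 < 6 * e by rewrite mulr_gt0.
have /choice[N Nf] : forall k, exists r : K -> nat, (forall x, (r x <= n)%N) /\
    oscillation_rank f (dyadic (6 * e) k) r.
  by move=> k; apply: finite_Baire_index_rank => //; exact: dyadic_gt0.
have fg2 x : `|f x - g x| <= 6 * e / 2 by rewrite (le_trans (fg x))//; lra.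
have [h [hb fgh]] :=
  dyadic_control c0 (fun k => (Nf k).1) (fun k => (Nf k).2) gp fg2.
exists g; split.
  (* On an empty [K] the bound [M] may be negative, so 0 replaces it. *)
  split=> //; have [x0|K0] := pselect (exists x : K, True); last first.
    by apply: (@constancy_rank_DBSC g p 0 n.*2.+1) => // x; case: K0; exists x.
  have M0 : 0 <= M by have [x _] := x0; rewrite (le_trans _ (fM x)).
  apply: (@constancy_rank_DBSC g p (M + 3 * e) n.*2.+1) => //.
    by rewrite addr_ge0// mulr_ge0// ltW.
  by move=> x; have := fM x; have := fg x; rewrite !ler_norml; lra.
rewrite (_ : (24 * n%:R + 9) * e = (24 * n%:R + 6) * e + 3 * e); last by ring.
apply: (oscillation_control_Dnorm fg _ fgh); last first.
  by rewrite addr_ge0// mulr_ge0 ?addr_ge0 ?mulr_ge0// ltW.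
move=> x; have /andP[-> hx] := hb x; rewrite (le_trans hx)//.
have : 6 * e * (p x)%:R <= 6 * e * (2 * n%:R + 1).
  by rewrite ler_pM2l// -natrM natr1 ler_nat mul2n.
by lra.
Qed.

End Main.

Theorem theorem1p2 (R : realType) (K : metricType R) (f : K -> R)
  (hK : separable_space K) (hf : finite_Baire_index f) : SD f.
Proof.
have [fb [n osn]] := hf.
have [M fM] : exists M : R, forall x, `|f x| <= M.
  have [M [_ fM]] := fb; exists (M + 1) => x.
  by apply: (fM (M + 1) _ x) => //; rewrite ltrDl.
have /choice[g gP] : forall k, exists g, simpleD g /\
    (Dnorm (f \- g)%R <= ((24 * n%:R + 9) * k.+1%:R^-1)%:E)%E.
  by move=> k; apply: simpleD_approximation fM osn; rewrite invr_gt0.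
exists g; split=> [k|]; first exact: (gP k).1.
apply: (@squeeze_cvge _ _ _ _ (cst 0%E) _
    (fun k => ((24 * n%:R + 9) * k.+1%:R^-1)%:E)).
- by apply: nearW => k; rewrite Dnorm_ge0 (gP k).2.
- exact: cvg_cst.
- apply: cvg_EFin; first exact: nearW.
  rewrite -[X in _ --> X](mulr0 (24 * n%:R + 9)).
  by apply: cvgM; [exact: cvg_cst|exact: cvg_harmonic].
Qed.
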